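(* Let $\mathcal{C}$ be an $[n,k]$ code over $\mathbb{F}_q$, where $q=p^r$, $p$ is prime and $r\ge1$ is an integer. Let $\alpha$ be a primitive element of $\mathbb{F}_q$ and let $\mathbf{g}_1,\dots,\mathbf{g}_k$ denote the rows of a standard generator matrix for $\mathcal{C}$. For $1\le i\le k$ and $1\le j\le q-1$, let $\mathbf{m}_i^{(j)}\in\mathbb{F}_q^{n-k}$ be the projection of the vector $(\mathbf{e}_i-\mathbf{g}_i)\alpha^j$ onto the last $n-k$ coordinates. Then the reduced Gröbner basis of the generalized code ideal $I_+(\mathcal{C})\subseteq\mathbb{K}[\mathbf{x}]$ with respect to the lexicographic order with $x_{11}\succ x_{12}\succ\dots\succ x_{n,q-1}$ is \begin{align*} \mathcal{G}=&\left\{x_{ij}-(\mathbf{x}_{k+1},\dots,\mathbf{x}_n)^{\phi^{(n-k)}(\mathbf{m}_i^{(j)})}\mid 1\le i\le k,\ 1\le j\le q-1\right\}\\ &\cup\left\{x_{ij}-\mathbf{x}_i^{\phi(\alpha^j)}\mid k+1\le i\le n,\ 1\le j\le q-r-1\right\}\\ &\cup\left\{x_{ij}^p-1\mid k+1\le i\le n,\ q-r\le j\le q-1\right\}. \end{align*}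
   Context: $\mathbb{K}$ is an arbitrary field; $\mathbb{F}_q=\{0,\alpha,\alpha^2,\dots,\alpha^{q-1}=1\}$. An $[n,k]$ code is a $k$-dimensional linear subspace of $\mathbb{F}_q^n$ (row vectors); a generator matrix is a $k\times n$ matrix whose rows form a basis of $\mathcal{C}$; it is standard (in standard form) if it equals $(I_k\mid M)$. $\mathbf{e}_i$ denotes the $i$th unit vector. Variables: $\mathbf{x}=(\mathbf{x}_1,\dots,\mathbf{x}_n)$ with $\mathbf{x}_j=(x_{j1},\dots,x_{j,q-1})$; the lexicographic order has variables ordered $x_{11}\succ\dots\succ x_{1,q-1}\succ x_{21}\succ\dots\succ x_{n,q-1}$. The maps $\phi$: the elements $\alpha^{q-r},\dots,\alpha^{q-2},\alpha^{q-1}$ form a basis of $\mathbb{F}_q$ over $\mathbb{F}_p$. Writing $\beta\in\mathbb{F}_q$ uniquely as $\beta=b_1\alpha^{q-r}+\dots+b_{r-1}\alpha^{q-2}+b_r\alpha^{q-1}$ with $b_1,\dots,b_r\in\mathbb{F}_p$, define the linear map $\phi:\mathbb{F}_q\to\mathbb{F}_p^{q-1}$, $\phi(\beta)=(0,\dots,0,b_1,\dots,b_r)$, and $\phi^{(s)}:\mathbb{F}_q^s\to\mathbb{F}_p^{(q-1)s}$, $\phi^{(s)}(\beta_1,\dots,\beta_s)=(\phi(\beta_1),\dots,\phi(\beta_s))$. When values of $\phi,\phi^{(s)}$ are used as exponents, entries in $\mathbb{F}_p$ are read as integers in $\{0,\dots,p-1\}$. Crossing map: $\blacktriangle:\mathbb{F}_q^n\to\mathbb{Z}^{n(q-1)}$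 sends $(a_1,\dots,a_n)$ to the concatenation of $n$ blocks of length $q-1$, where the $j$th block is the unit vector $\mathbf{e}_{u}$ if $a_j=\alpha^{u}$ with $1\le u\le q-1$, and the zero vector if $a_j=0$. Thus $\mathbf{x}^{\blacktriangle a}=\prod_{j:\,a_j=\alpha^{u_j}\neq0}x_{j,u_j}$. The ideal $I_q$ of $\mathbb{K}[\mathbf{x}]$ is generated, for all $1\le j\le n$ and $1\le u,v,w\le q-1$, by the binomials $x_{ju}x_{jv}-x_{jw}$ whenever $\alpha^u+\alpha^v=\alpha^w$, and $x_{ju}x_{jv}-1$ whenever $\alpha^u+\alpha^v=0$ ($u=v$ allowed). Generalized code ideal: $$I_+(\mathcal{C})=\langle\mathbf{x}^{\blacktriangle a}-\mathbf{x}^{\blacktriangle b}\mid a,b\in\mathbb{F}_q^n,\ a-b\in\mathcal{C}\rangle+I_q\subseteq\mathbb{K}[\mathbf{x}].$$ The reduced Gröbner basis of an ideal is its unique Gröbner basis consisting of monic polynomials such that no term of any element is divisible by the leading term of another element. *)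

(* Defs.v *)
From HB Require Import structures.
From mathcomp Require Export all_boot all_algebra.
From mathcomp Require Import falgebra fieldext galois finfield.
From mathcomp.multinomials Require Export mpoly.

Set Implicit Arguments.
Unset Strict Implicit.
Unset Printing Implicit Defensive.

Import GRing.Theory.
Local Open Scope ring_scope.

(** * Ideals given as predicates *)

Definition ideal_gen (R : comNzRingType) (S : R -> Prop) : R -> Prop :=
  fun f => exists2 s : seq (R * R),
    forall c, c \in s -> S c.2 & f = \sum_(c <- s) c.1 * c.2.

Definition ideal_sum (R : comNzRingType) (I J : R -> Prop) : R -> Prop :=
  fun f => exists a b, [/\ I a, J b & f = a + b].

(** * Groebner bases with respect to a monomial order [le] *)

(* Lexicographic order in which the variable of index 0 is the largest one. *)
Definition mlex (N : nat) : rel 'X_{1..N} := fun m1 m2 =>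
  (m1 == m2) ||
  [exists i : 'I_N, (m1 i < m2 i)%N &&
     [forall j : 'I_N, (j < i)%N ==> (m1 j == m2 j)]].

(* [m] is the leading monomial of [f]; the zero polynomial has none. *)
Definition is_lm (K : fieldType) (N : nat) (le : rel 'X_{1..N})
    (f : {mpoly K[N]}) (m : 'X_{1..N}) : Prop :=
  m \in msupp f /\ forall m', m' \in msupp f -> le m' m.

Definition lt_ideal (K : fieldType) (N : nat) (le : rel 'X_{1..N})
    (S : {mpoly K[N]} -> Prop) : {mpoly K[N]} -> Prop :=
  ideal_gen (fun t => exists f m,
    [/\ S f, is_lm le f m & t = f@_m *: 'X_[m]]).

Definition is_groebner (K : fieldType) (N : nat) (le : rel 'X_{1..N})
    (I G : {mpoly K[N]} -> Prop) : Prop :=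
  [/\ exists s : seq {mpoly K[N]}, forall g, G g <-> g \in s,
      forall g, G g -> I g
    & forall f, lt_ideal le G f <-> lt_ideal le I f].

Definition is_reduced_groebner (K : fieldType) (N : nat) (le : rel 'X_{1..N})
    (I G : {mpoly K[N]} -> Prop) : Prop :=
  [/\ is_groebner le I G,
      forall g, G g -> exists2 m, is_lm le g m & g@_m = 1
    & forall g h m m', G g -> G h -> g <> h -> m \in msupp g ->
        is_lm le h m' -> ~~ (m' <= m)%MM].

(** * The variables x_{iu} *)

(* Block indices [i] and positions [u] within a block count from 0, so [u]
   stands for the exponent [u.+1] of the primitive element. *)
Definition xvar (K : fieldType) (n w : nat) (i : 'I_n) (u : 'I_w) :
  {mpoly K[n * w]} := 'X_(mxvec_index i u).

Arguments xvar K {n w} i u.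

Lemma mxvec_indexE (n w : nat) (i : 'I_n) (u : 'I_w) :
  mxvec_index i u = (i * w + u)%N :> nat.
Proof.
have nthA (T1 T2 : Type) (x1 : T1) (x2 : T2) (s : seq T1) (t : seq T2) a b :
    (a < size s)%N -> (b < size t)%N ->
  nth (x1, x2) [seq (y, z) | y <- s, z <- t] (a * size t + b)
    = (nth x1 s a, nth x2 t b).
  elim: s a => [|y s IHs] [|a] //= ha hb.
    by rewrite nth_cat size_map hb (nth_map x2).
  rewrite nth_cat size_map mulSn -addnA ltnNge leq_addr /= addKn.
  exact: IHs.
have lt_iu : (i * w + u < #|{: 'I_n * 'I_w}|)%N.
  rewrite card_prod !card_ord.
  by rewrite (leq_trans (n := (i.+1 * w)%N)) ?leq_mul2r ?ltn_ord ?orbT //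
             mulSnr ltn_add2l.
rewrite /= -[RHS]/(Ordinal lt_iu : nat); congr (nat_of_ord _).
apply: enum_val_inj; rewrite enum_rankK (enum_val_nth (i, u)) /= enumT.
rewrite unlock /= /prod_enum.
have := nthA _ _ i u (enum 'I_n) (enum 'I_w) i u.
by rewrite !size_enum_ord !nth_ord_enum !ltn_ord => ->.
Qed.

(* Row [t] of [E] is the exponent vector of the block of variables [h t]. *)
Definition xpow (K : fieldType) (n w s : nat) (h : 'I_s -> 'I_n)
    (E : 'M[nat]_(s, w)) : {mpoly K[n * w]} :=
  \prod_(t < s) \prod_(u < w) xvar K (h t) u ^+ E t u.

(** * Codes and code ideals *)

Definition is_generator_matrix (F : fieldType) (n k : nat)
    (C : {vspace 'rV[F]_n}) (G : 'M[F]_(k, n)) : Prop :=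
  basis_of C [tuple row i G | i < k].

Definition is_standard (F : fieldType) (k l : nat) (G : 'M[F]_(k, k + l)) :
  Prop := exists M : 'M[F]_(k, l), G = row_mx 1%:M M.

(* The crossing map: block [j] of the result is row [j]. Its entries are 0 or
   1, so nat is used in place of the integers. *)
Definition cross (F : finFieldType) (alpha : F) (n : nat) (a : 'rV[F]_n) :
  'M[nat]_(n, #|F|.-1) := \matrix_(j, u) (a 0 j == alpha ^+ u.+1 : nat).

Definition Iq (K : fieldType) (F : finFieldType) (alpha : F) (n : nat) :
    {mpoly K[n * #|F|.-1]} -> Prop :=
  ideal_gen (fun f =>
    (exists (j : 'I_n) (u v w : 'I_(#|F|.-1)),
       alpha ^+ u.+1 + alpha ^+ v.+1 = alpha ^+ w.+1 /\
       f = xvar K j u * xvar K j v - xvar K j w) \/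
    (exists (j : 'I_n) (u v : 'I_(#|F|.-1)),
       alpha ^+ u.+1 + alpha ^+ v.+1 = 0 /\
       f = xvar K j u * xvar K j v - 1)).

Arguments Iq K {F} alpha n.

Definition gen_code_ideal (K : fieldType) (F : finFieldType) (alpha : F)
    (n : nat) (C : {vspace 'rV[F]_n}) : {mpoly K[n * #|F|.-1]} -> Prop :=
  ideal_sum
    (ideal_gen (fun f => exists a b : 'rV[F]_n, a - b \in C /\
       f = xpow K id (cross alpha a) - xpow K id (cross alpha b)))
    (Iq K alpha n).

Arguments gen_code_ideal K {F} alpha {n} C.

(** * The maps phi *)

(* [b] holds coordinates of [beta] with respect to the powers of [alpha] with
   exponents q - r, ..., q - 1; an element of F_p acts on F through its
   representative in {0, ..., p - 1}. *)
Definition is_phi (F : finFieldType) (p r : nat) (alpha beta : F)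
    (b : 'rV['F_p]_(#|F|.-1)) : bool :=
  [forall u : 'I_(#|F|.-1), (u.+1 < #|F| - r)%N ==> (b 0 u == 0)] &&
  (beta == \sum_(u < #|F|.-1) (b 0 u : nat)%:R * alpha ^+ u.+1).

(* By [phi_exists_unique] the default value 0 plays no role when [alpha] is
   primitive and #|F| = p ^ r. *)
Definition phi (F : finFieldType) (p r : nat) (alpha beta : F) :
  'rV['F_p]_(#|F|.-1) := odflt 0 [pick b | is_phi r alpha beta b].

Arguments phi {F} p r alpha beta.

Lemma phi_repr (F : finFieldType) (p r : nat) (alpha : F) :
  prime p -> #|F| = (p ^ r)%N -> (#|F|.-1).-primitive_root alpha ->
  forall beta, exists c : 'rV['F_p]_r,
    beta = \sum_(t < r) (c 0 t : nat)%:R * alpha ^+ t.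
Proof.
move=> p_pr cardF alphaP beta.
have pcharF := card_finPcharP cardF p_pr.
pose L := pPrimeCharType pcharF.
have alpha_gen (x : F) : exists j, x = 0 \/ x = alpha ^+ j.
  have [->|x0] := eqVneq x 0; first by exists 0%N; left.
  have xu : x ^+ #|F|.-1 = 1.
    by apply: (mulIf x0); rewrite mul1r -exprSr prednK ?expf_card // (cardD1 0).
  by have [j ->] := prim_rootP alphaP xu; exists j; right.
have full : <<1%VS; (alpha : L)>>%VS = fullv.
  apply/eqP; rewrite eqEsubv subvf /=; apply/subvP => x _.
  have [j [->|->]] := alpha_gen x; first exact: mem0v.
  by apply: rpredX; apply: memv_adjoin.
have degr : adjoin_degree 1%AS (alpha : L) = r.
  have := dim_Fadjoin 1%AS (alpha : L).
  by rewrite full pprimeChar_dimf cardF pfactorK // dimv1 muln1 => ->.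
have beta_in : (beta : L) \in <<1%AS; (alpha : L)>>%VS by rewrite full memvf.
have /polyOverP P1 := Fadjoin_polyOver 1%AS (alpha : L) beta.
have szP := size_Fadjoin_poly 1%AS (alpha : L) beta.
have := Fadjoin_poly_eq beta_in; move: P1 szP; rewrite degr.
set P := Fadjoin_poly _ _ _ => P1 szP Pb.
have cP (t : 'I_r) : exists a : 'F_p, P`_t == (a : nat)%:R.
  have /vlineP[a Ea] := P1 t; exists a; apply/eqP.
  by rewrite Ea /GRing.scale /= /pprimeChar_scale mulr1.
exists (\row_t xchoose (cP t)).
rewrite -[LHS]Pb (horner_coef_wide _ szP).
by apply: eq_bigr => t _; rewrite mxE -(eqP (xchooseP (cP t))).
Qed.

Lemma phi_bij (F : finFieldType) (p r : nat) (alpha : F) :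
  prime p -> #|F| = (p ^ r)%N -> (#|F|.-1).-primitive_root alpha ->
  bijective (fun c : 'rV['F_p]_r =>
    \sum_(t < r) (c 0 t : nat)%:R * alpha ^+ t).
Proof.
move=> p_pr cardF alphaP; set f := fun c => _.
have card_dom : #|{: 'rV['F_p]_r}| = #|F|.
  by rewrite card_mx mul1n card_Fp // cardF.
apply: inj_card_bij; last by rewrite card_dom.
apply: in2T; apply/image_injP; rewrite [X in _ == X]card_dom; apply/eqP.
apply: eq_card => x; rewrite inE; apply/imageP.
by have [c ->] := phi_repr p_pr cardF alphaP x; exists c.
Qed.

Lemma phi_exists_unique (F : finFieldType) (p r : nat) (alpha beta : F) :
  prime p -> #|F| = (p ^ r)%N -> (#|F|.-1).-primitive_root alpha ->
  exists! b : 'rV['F_p]_(#|F|.-1), is_phi r alpha beta b.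
Proof.
move=> p_pr cardF alphaP.
have [g fK gK] := phi_bij p_pr cardF alphaP.
have alpha0 : alpha != 0.
  apply/eqP=> a0; have := prim_expr_order alphaP.
  rewrite a0 expr0n gtn_eqF ?(prim_order_gt0 alphaP) // => /eqP.
  by rewrite eq_sym oner_eq0.
have lt_r : (r < #|F|)%N by rewrite cardF ltn_expl ?prime_gt1.
have [d Ew] : exists d, (#|F|.-1 = d + r)%N.
  by exists (#|F|.-1 - r)%N; rewrite subnK // -ltnS prednK // (leq_trans _ lt_r).
have Ed : (#|F| - r = d.+1)%N.
  by rewrite -[#|F|]prednK ?(leq_trans _ lt_r) // Ew -addSn addnK.
rewrite /is_phi Ed; move: (#|F|.-1) Ew => w -> {w Ed alphaP}.
have sumE (b : 'rV['F_p]_(d + r)) : (forall u : 'I_(d + r), (u < d)%N -> b 0 u = 0) ->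
  \sum_(u < d + r) (b 0 u : nat)%:R * alpha ^+ u.+1 =
  alpha ^+ d.+1 * \sum_(t < r) (rsubmx b 0 t : nat)%:R * alpha ^+ t.
  move=> b0; rewrite big_split_ord /= big1 ?add0r => [|u _]; last first.
    by rewrite b0 ?mul0r //= ltn_ord.
  rewrite mulr_sumr; apply: eq_bigr => t _.
  by rewrite mxE mulrCA -exprD addSn.
have ad : alpha ^+ d.+1 != 0 by rewrite expf_neq0.
exists (row_mx 0 (g (beta / alpha ^+ d.+1))); split.
  set b := row_mx _ _.
  have b0 (u : 'I_(d + r)) : (u < d)%N -> b 0 u = 0.
    move=> ud; rewrite /b -[u](_ : lshift r (Ordinal ud) = u) ?row_mxEl ?mxE //.
    exact: val_inj.
  apply/andP; split.
    by apply/forallP => u; apply/implyP; rewrite ltnS => /b0 ->.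
  by rewrite sumE // /b row_mxKr gK mulrC divfK.
move=> b /andP[/forallP b0 /eqP ->].
have {}b0 (u : 'I_(d + r)) : (u < d)%N -> b 0 u = 0.
  by move=> ud; apply/eqP; apply: (implyP (b0 u)); rewrite ltnS.
rewrite sumE // mulrAC divff // mul1r fK -[RHS]hsubmxK; congr row_mx.
by apply/rowP => u; rewrite !mxE b0 //= ltn_ord.
Qed.

Lemma phiP (F : finFieldType) (p r : nat) (alpha beta : F) :
  prime p -> #|F| = (p ^ r)%N -> (#|F|.-1).-primitive_root alpha ->
  is_phi r alpha beta (phi p r alpha beta).
Proof.
move=> p_pr cardF alphaP.
have [b [bP _]] := phi_exists_unique beta p_pr cardF alphaP.
by rewrite /phi; case: pickP => [//|/(_ b)]; rewrite bP.
Qed.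

Lemma phi_uniq (F : finFieldType) (p r : nat) (alpha beta : F)
    (b : 'rV['F_p]_(#|F|.-1)) :
  prime p -> #|F| = (p ^ r)%N -> (#|F|.-1).-primitive_root alpha ->
  is_phi r alpha beta b -> b = phi p r alpha beta.
Proof.
move=> p_pr cardF alphaP bP.
have [b' [_ b'U]] := phi_exists_unique beta p_pr cardF alphaP.
by rewrite -(b'U b bP) -(b'U _ (phiP beta p_pr cardF alphaP)).
Qed.

(* phi^(s), the image of coordinate [t] being row [t]. *)
Definition phis (F : finFieldType) (p r : nat) (alpha : F) (s : nat)
    (v : 'rV[F]_s) : 'M['F_p]_(s, #|F|.-1) :=
  \matrix_(t, u) phi p r alpha (v 0 t) 0 u.

Arguments phis {F} p r alpha {s} v.

Definition rep (p s w : nat) (E : 'M['F_p]_(s, w)) : 'M[nat]_(s, w) :=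
  map_mx (fun c : 'F_p => c : nat) E.

(** * The candidate basis, for codes of length n = k + l *)

Definition mvec (F : finFieldType) (alpha : F) (k l : nat)
    (G : 'M[F]_(k, k + l)) (i : 'I_k) (j : 'I_(#|F|.-1)) : 'rV[F]_l :=
  rsubmx (alpha ^+ j.+1 *: (delta_mx 0 (lshift l i) - row i G)).

Definition basis_polys (K : fieldType) (F : finFieldType) (p r : nat)
    (alpha : F) (k l : nat) (G : 'M[F]_(k, k + l))
    (f : {mpoly K[(k + l) * #|F|.-1]}) : Prop :=
  [\/ exists (i : 'I_k) (j : 'I_(#|F|.-1)),
        f = xvar K (lshift l i) j -
            xpow K (@rshift k l) (rep (phis p r alpha (mvec alpha G i j))),
      exists (i : 'I_l) (j : 'I_(#|F|.-1)), (j.+1 <= #|F| - r - 1)%N /\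
        f = xvar K (rshift k i) j -
            xpow K (fun _ : 'I_1 => rshift k i)
              (rep (phi p r alpha (alpha ^+ j.+1)))
    | exists (i : 'I_l) (j : 'I_(#|F|.-1)), (#|F| - r <= j.+1)%N /\
        f = xvar K (rshift k i) j ^+ p - 1].

Arguments basis_polys K {F} p r alpha {k l} G f.

(* Main.v *)
Require Import Defs.
From mathcomp Require Import finfield.

Set Implicit Arguments.
Unset Strict Implicit.
Unset Printing Implicit Defensive.

Import GRing.Theory.
Local Open Scope ring_scope.

(** Reading the variable x_{iu} as the vector with entry alpha^(u+1) in
    position i turns a monomial into a vector of F^n ([coords]), additively in
    the exponents.  Composing with the parity check matrix (-M^T | I) of the
    standard generator matrix (I | M) gives the syndrome [synd], an additive
    map from monomials to F^l whose fibres are the classes of monomials modulo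
    the code.  The code ideal sees exactly these fibres:
    - two monomials with the same syndrome differ by an element of the ideal,
      since the relations in I_q turn any monomial into the crossing monomial
      of its vector ([code_ideal_binomial]);
    - all generators are differences of two monomials with the same syndrome,
      so the coefficients of an element of the ideal sum to 0 over each fibre
      ([code_ideal_balanced]).

    Call a monomial standard if it involves only the variables of the last l
    blocks at the last r positions, with exponents below p.  As
    alpha^(q-r), ..., alpha^(q-1) is a basis of F over F_p, each syndrome c is
    that of a standard monomial [nf c], whose exponents are phi^(l)(c).  The
    point that makes the lexicographic order fit is [nf_min]: a standard
    monomial m is the least one with its syndrome.  Indeed let m' have the same
    syndrome and a smaller exponent at the first place where the two differ.
    That exponent of m is positive, so the place is one of the variables just
    described; the first k blocks come before it, so m' vanishes there as m does.
    Then equal syndromes mean equal vectors, and uniqueness of coordinates over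
    F_p in the block at hand gives equal exponents modulo p at that place, hence
    equal exponents, as both are below p.

    The rest is about classes of monomials ([staircase_reduced_groebner]).  The
    leading monomial of an element of the ideal cannot be standard: the sum of
    coefficients over its fibre would consist of that single nonzero
    coefficient.  So it is divisible by a minimal nonstandard monomial, that
    is by x_v or, for the variables occurring in standard monomials, by x_v^p.
    Subtracting from these corners the standard monomial of the same syndrome
    gives the reduced basis, and these differences are the three families of
    the theorem ([basis_polys_corner]). *)

(** * The lexicographic order *)

Lemma mlexxx (N : nat) (m : 'X_{1..N}) : mlex m m.
Proof. by rewrite /mlex eqxx. Qed.

Lemma mlex_anti (N : nat) (m1 m2 : 'X_{1..N}) :
  mlex m1 m2 -> mlex m2 m1 -> m1 = m2.
Proof.
case/orP=> [/eqP //|/existsP[i /andP[lt_i /forallP eq_i]]].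
case/orP=> [/eqP //|/existsP[j /andP[lt_j /forallP eq_j]]].
have [ij|ji|/val_inj ij] := ltngtP i j.
- by move: (eq_j i) lt_i; rewrite ij /= => /eqP->; rewrite ltnn.
- by move: (eq_i j) lt_j; rewrite ji /= => /eqP->; rewrite ltnn.
by move: lt_i; rewrite ij ltnNge ltnW.
Qed.

(** Gives totality of [mlex] together with the information on the earlier
    variables that [nf_min] uses. *)
Lemma mnm_first_diff (N : nat) (m1 m2 : 'X_{1..N}) : m1 != m2 ->
  exists2 i : 'I_N, m1 i != m2 i & forall j : 'I_N, (j < i)%N -> m1 j = m2 j.
Proof.
move=> neq12; have [i neq_i|eq12] := pickP (fun i => m1 i != m2 i); last first.
  by case/eqP: neq12; apply/mnmP=> i; apply/eqP/negPn; rewrite eq12.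
case: (@arg_minnP _ i (fun j => m1 j != m2 j) val neq_i) => j neq_j min_j.
exists j => // t lt_tj; apply/eqP; rewrite -[_ == _]negbK.
by apply/negP=> /min_j; rewrite leqNgt lt_tj.
Qed.

(** * Ideals given by generators *)

Section IdealGen.
Variables (R : comNzRingType) (S : R -> Prop).

Lemma ideal_gen_mem x : S x -> ideal_gen S x.
Proof.
by exists [:: (1, x)] => [c /[!inE]/eqP->//|]; rewrite big_seq1 mul1r.
Qed.

Lemma ideal_gen0 : ideal_gen S 0.
Proof. by exists [::]; rewrite ?big_nil. Qed.

Lemma ideal_genD x y : ideal_gen S x -> ideal_gen S y -> ideal_gen S (x + y).
Proof.
case=> s Ss -> [t St ->]; exists (s ++ t); last by rewrite big_cat.
by move=> c; rewrite mem_cat => /orP[/Ss|/St].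
Qed.

Lemma ideal_genM a x : ideal_gen S x -> ideal_gen S (a * x).
Proof.
case=> s Ss ->; exists [seq (a * c.1, c.2) | c <- s].
  by move=> _ /mapP[c /Ss Sc ->].
by rewrite big_map mulr_sumr; apply: eq_bigr => c _ /=; rewrite mulrA.
Qed.

Lemma ideal_gen_min (P : R -> Prop) x :
  P 0 -> (forall y z, P y -> P z -> P (y + z)) ->
  (forall a y, S y -> P (a * y)) -> ideal_gen S x -> P x.
Proof.
move=> P0 PD PM [s Ss ->]; elim: s Ss => [|c s IHs] Ss; first by rewrite big_nil.
rewrite big_cons; apply: PD; first by apply/PM/Ss; rewrite mem_head.
by apply: IHs => d ds; apply: Ss; rewrite inE ds orbT.
Qed.

End IdealGen.

Lemma ideal_gen_trans (R : comNzRingType) (S T : R -> Prop) x :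
  (forall y, S y -> ideal_gen T y) -> ideal_gen S x -> ideal_gen T x.
Proof.
move=> ST; apply: ideal_gen_min => [|y z|a y /ST]; first exact: ideal_gen0.
  exact: ideal_genD.
exact: ideal_genM.
Qed.

(** * Polynomials whose coefficients cancel along each class of monomials *)

Section Grading.
Variables (K : fieldType) (N : nat) (V : zmodType) (cls : 'X_{1..N} -> V).
Hypothesis clsD : {morph cls : m1 m2 / (m1 + m2)%MM >-> m1 + m2}.

(** The functionals summing the coefficients over a fibre of [cls], all zero.
    The sum runs over the monomials of bounded degree, which are finitely many;
    allowing every large bound makes the property visibly additive in [f]. *)
Definition class_balanced (f : {mpoly K[N]}) : Prop :=
  exists d0, forall d c, (d0 <= d)%N ->
    \sum_(m : 'X_{1..N < d} | cls m == c) f@_m = 0.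

Lemma class_balanced0 : class_balanced 0.
Proof. by exists 0%N => d c _; apply: big1 => m _; rewrite mcoeff0. Qed.

Lemma class_balancedD f g :
  class_balanced f -> class_balanced g -> class_balanced (f + g).
Proof.
case=> d1 f0 [d2 g0]; exists (maxn d1 d2) => d c; rewrite geq_max => /andP[h1 h2].
under eq_bigr do rewrite mcoeffD.
by rewrite big_split /= f0 // g0 // addr0.
Qed.

Lemma sum_class_monomial d c (u : 'X_{1..N}) : (mdeg u < d)%N ->
  \sum_(m : 'X_{1..N < d} | cls m == c) 'X_[u]@_m = (cls u == c)%:R :> K.
Proof.
move=> ud; have [cu|cu] := boolP (cls u == c).
  rewrite (bigD1 (BMultinom ud)) //= mcoeffX eqxx big1 ?addr0 // => m.
  by case/andP=> _ /negPf mu; rewrite mcoeffX eq_sym -[_ == u]/(m == BMultinom ud) mu.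
apply: big1 => m cm; rewrite mcoeffX; case: eqP => // um.
by rewrite um cm in cu.
Qed.

(** Both monomials of the binomial move to the same fibre under multiplication
    by a monomial, because [cls] is additive. *)
Lemma class_balanced_binomial a b (g : {mpoly K[N]}) :
  cls a = cls b -> class_balanced (g * ('X_[a] - 'X_[b])).
Proof.
move=> ab; rewrite [g]mpolyE mulr_suml.
elim: (msupp g) => [|u s IHs]; first by rewrite big_nil; apply: class_balanced0.
rewrite big_cons; apply: class_balancedD => //.
exists (maxn (mdeg (u + a)) (mdeg (u + b))).+1 => d c; rewrite gtn_max => /andP[ha hb].
rewrite mulrBr -!scalerAl -!mpolyXD.
under eq_bigr do rewrite mcoeffB !mcoeffZ.
by rewrite sumrB -!mulr_sumr !sum_class_monomial // !clsD ab subrr.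
Qed.

Lemma class_balanced_ideal (S : {mpoly K[N]} -> Prop) f :
  (forall g, S g -> exists a b, cls a = cls b /\ g = 'X_[a] - 'X_[b]) ->
  ideal_gen S f -> class_balanced f.
Proof.
move=> bin; apply: ideal_gen_min => [|y z|g y /bin[a [b [ab ->]]]].
- exact: class_balanced0.
- exact: class_balancedD.
exact: class_balanced_binomial.
Qed.

(** The nonzero coefficient of the leading monomial has to be cancelled within
    its fibre, hence by a smaller monomial. *)
Lemma class_balanced_lm f m : class_balanced f -> is_lm (@mlex N) f m ->
  exists m', [/\ m' != m, mlex m' m & cls m' = cls m].
Proof.
case=> d0 f0 [fm lm_m]; pose d := maxn d0 (mdeg m).+1.
have md : (mdeg m < d)%N by rewrite leq_max ltnSn orbT.
have := f0 d (cls m) (leq_maxl _ _).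
rewrite (bigD1 (BMultinom md)) //= => sum0.
have [m' /and3P[/eqP cm' m'm f_m']|none] :=
  pickP (fun m' : 'X_{1..N < d} =>
    [&& cls m' == cls m, m' != BMultinom md & (m' : 'X_{1..N}) \in msupp f]).
  by exists m'; split=> //; apply: lm_m.
move: sum0; rewrite big1 ?addr0 => [/eqP|m' /andP[cm' m'm]].
  by rewrite mcoeff_eq0 fm.
by apply/eqP; rewrite mcoeff_eq0; move: (none m'); rewrite cm' m'm /= => ->.
Qed.

End Grading.

(** * Staircases of least representatives *)

Section Staircase.
Variables (K : fieldType) (N : nat) (V : zmodType) (cls : 'X_{1..N} -> V).
Variables (d : 'I_N -> nat) (nf : V -> 'X_{1..N}).
Variables (I B : {mpoly K[N]} -> Prop).
Hypothesis nf_std : forall c v, (nf c v < d v)%N.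
Hypothesis nfK : cancel nf cls.
Hypothesis std_min : forall m m' : 'X_{1..N}, (forall v, m v < d v)%N ->
  cls m = cls m' -> mlex m m'.
Hypothesis I_binomial : forall m m', cls m = cls m' -> I ('X_[m] - 'X_[m']).
Hypothesis I_balanced : forall f, I f -> class_balanced cls f.

(** With [m v < d v] for all [v] defining the standard monomials, the minimal
    nonstandard ones are the [d v]-th powers of the variables. *)
Definition corner v : 'X_{1..N} := (U_(v) *+ d v)%MM.
Definition corner_tail v : 'X_{1..N} := nf (cls (corner v)).

Hypothesis B_corner :
  forall f, B f <-> exists v, f = 'X_[corner v] - 'X_[corner_tail v].

Lemma cornerE v u : corner v u = ((v == u) * d v)%N.
Proof. by rewrite /corner mulmnE mnm1E. Qed.

Lemma corner_tail_neq v : corner v != corner_tail v.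
Proof.
apply/eqP=> /mnmP/(_ v); rewrite cornerE eqxx mul1n => e.
by have := nf_std (cls (corner v)) v; rewrite -[nf _ v]e ltnn.
Qed.

Lemma msupp_binomial (a b m : 'X_{1..N}) :
  m \in msupp ('X_[a] - 'X_[b] : {mpoly K[N]}) -> m = a \/ m = b.
Proof.
rewrite mcoeff_msupp mcoeffB !mcoeffX.
have [->|_] := eqVneq a m; first by left.
by have [->|_] := eqVneq b m; [right|rewrite subrr eqxx].
Qed.

Lemma corner_coef v : ('X_[corner v] - 'X_[corner_tail v] : {mpoly K[N]})@_(corner v) = 1.
Proof.
by rewrite mcoeffB !mcoeffX eqxx eq_sym (negPf (corner_tail_neq v)) subr0.
Qed.

(** The tail is standard, so it is below the corner, which lies in its class. *)
Lemma corner_lm v :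
  is_lm (@mlex N) ('X_[corner v] - 'X_[corner_tail v] : {mpoly K[N]}) (corner v).
Proof.
split; first by rewrite mcoeff_msupp corner_coef oner_eq0.
move=> m' /msupp_binomial[->|->]; first exact: mlexxx.
by apply: std_min; rewrite ?nfK // => u; apply: nf_std.
Qed.

Lemma lm_corner v m :
  is_lm (@mlex N) ('X_[corner v] - 'X_[corner_tail v] : {mpoly K[N]}) m ->
  m = corner v.
Proof.
case=> fm lm_m; have [fv lm_v] := corner_lm v.
by apply: mlex_anti; [apply: lm_v | apply: lm_m].
Qed.

(** A standard leading monomial would be least in its class, which
    [class_balanced_lm] excludes; so leading monomials of [I] are multiples of
    corners. *)
Lemma staircase_groebner : is_groebner (@mlex N) I B.
Proof.
have BI g : B g -> I g by case/B_corner=> v ->; apply: I_binomial; rewrite nfK.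
split=> //.
  exists (codom (fun v => 'X_[corner v] - 'X_[corner_tail v] : {mpoly K[N]})) => g.
  split=> [/B_corner[v ->]|/codomP[v ->]]; first exact: codom_f.
  by apply/B_corner; exists v.
move=> f; split; apply: ideal_gen_trans => _ [g [m [Hg lm_m ->]]].
  by apply: ideal_gen_mem; exists g, m; split=> //; apply: BI.
have [std|] := boolP [forall v, m v < d v]%N.
  have [m' [m'm le_m'm cm']] := class_balanced_lm (I_balanced Hg) lm_m.
  case/eqP: m'm; apply: mlex_anti => //; apply: std_min => // v.
  exact: (forallP std).
rewrite negb_forall => /existsP[v]; rewrite -leqNgt => dv.
have le_vm : (corner v <= m)%MM.
  apply/mnm_lepP => u; rewrite cornerE.
  by have [<-|_] := eqVneq v u; rewrite ?mul1n ?mul0n.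
rewrite -(submK le_vm) mpolyXD scalerAl; apply/ideal_genM/ideal_gen_mem.
exists ('X_[corner v] - 'X_[corner_tail v]), (corner v).
rewrite corner_coef scale1r; split=> //; last exact: corner_lm.
by apply/B_corner; exists v.
Qed.

(** Only corners are leading monomials, and no corner divides another one or a
    standard monomial. *)
Lemma staircase_reduced_groebner : is_reduced_groebner (@mlex N) I B.
Proof.
split; first exact: staircase_groebner.
  move=> g /B_corner[v ->]; exists (corner v); first exact: corner_lm.
  exact: corner_coef.
move=> g h m m' /B_corner[v ->] /B_corner[u ->] neq /msupp_binomial mE.
move=> /lm_corner->; apply/negP=> /mnm_lepP/(_ u).
rewrite cornerE eqxx mul1n leqNgt => /negP; apply.
case: mE => ->; last exact: nf_std.
rewrite cornerE; case: (eqVneq v u) neq => [->|_ _]; first by case.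
exact: leq_ltn_trans (nf_std 0 u).
Qed.

End Staircase.

(** * Monomials in the block variables *)

(** The row-major order of [mxvec] is that of the variables. *)
Definition mnmx (n w : nat) (E : 'M[nat]_(n, w)) : 'X_{1..n * w} :=
  [multinom mxvec E 0%R v | v < n * w].

Lemma mnmxE n w (E : 'M[nat]_(n, w)) i u : mnmx E (mxvec_index i u) = E i u.
Proof. by rewrite mnmE mxvecE. Qed.

Lemma big_mxvec_index (R : comNzRingType) n w (f : 'I_(n * w) -> R) :
  \prod_v f v = \prod_(i < n) \prod_(u < w) f (mxvec_index i u).
Proof.
rewrite pair_big /= (reindex _ (curry_mxvec_bij n w)).
by apply: eq_bigr => -[i u] _.
Qed.

Lemma mpolyX_blocks (K : fieldType) n w (m : 'X_{1..n * w}) :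
  'X_[m] = \prod_(i < n) \prod_(u < w) xvar K i u ^+ m (mxvec_index i u).
Proof. by rewrite mpolyXE_id big_mxvec_index. Qed.

Lemma xpow_id (K : fieldType) n w (E : 'M[nat]_(n, w)) : xpow K id E = 'X_[mnmx E].
Proof.
rewrite mpolyX_blocks; apply: eq_bigr => i _; apply: eq_bigr => u _.
by rewrite mnmxE.
Qed.

(** Lets a product over the last blocks be compared, as a monomial, with
    monomials in all variables. *)
Lemma xpow_rshift (K : fieldType) k l w (E : 'M[nat]_(l, w)) :
  xpow K (@rshift k l) E = 'X_[mnmx (col_mx 0 E)].
Proof.
rewrite -xpow_id [RHS]big_split_ord /= big1 ?mul1r => [|i _].
  by apply: eq_bigr => i _; apply: eq_bigr => u _; rewrite col_mxEd.
by apply: big1 => u _; rewrite col_mxEu mxE expr0.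
Qed.

Lemma xpow_single (K : fieldType) n w (i : 'I_n) (E : 'M[nat]_(1, w)) :
  xpow K (fun _ : 'I_1 => i) E =
  xpow K id (\matrix_(j < n) if j == i then row 0 E else 0).
Proof.
rewrite /xpow big_ord1 [RHS](bigD1 i) //= [X in _ * X]big1 ?mulr1 => [|j /negPf ji].
  by apply: eq_bigr => u _; rewrite !mxE eqxx mxE.
by apply: big1 => u _; rewrite !mxE ji mxE expr0.
Qed.

(** * The vector of a monomial *)

Section Coords.
Variables (F : finFieldType) (alpha : F) (n : nat).
Notation w := #|F|.-1.

(** The inverse of the crossing map up to the relations of the ideal [Iq]:
    the variable x_{iu} counts as the vector with entry [alpha ^+ u.+1] in
    position [i]. *)
Definition coords (m : 'X_{1..n * w}) : 'rV[F]_n :=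
  \row_i \sum_(u < w) (m (mxvec_index i u))%:R * alpha ^+ u.+1.

Lemma coordsD m1 m2 : coords (m1 + m2)%MM = coords m1 + coords m2.
Proof.
apply/rowP=> i; rewrite !mxE -big_split; apply: eq_bigr => u _ /=.
by rewrite mnmDE natrD mulrDl.
Qed.

Lemma coords0 : coords 0%MM = 0.
Proof. by apply/rowP=> i; rewrite !mxE big1 // => u _; rewrite mnm0E mul0r. Qed.

Lemma coordsMn m e : coords (m *+ e)%MM = e%:R *: coords m.
Proof.
apply/rowP=> i; rewrite !mxE mulr_sumr; apply: eq_bigr => u _.
by rewrite mulmnE mulnC natrM mulrA.
Qed.

Lemma mxvec_index_eq (i j : 'I_n) (u v : 'I_w) :
  (mxvec_index i u == mxvec_index j v) = (i == j) && (u == v).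
Proof.
by rewrite /mxvec_index (inj_eq (@cast_ord_inj _ _ _)) (inj_eq enum_rank_inj).
Qed.

Lemma coordsU i u : coords U_(mxvec_index i u)%MM = alpha ^+ u.+1 *: delta_mx 0 i.
Proof.
apply/rowP=> j; rewrite !mxE eqxx /= (bigD1 u) //= big1 ?addr0 => [|v vu].
  by rewrite mnm1E mxvec_index_eq eqxx andbT eq_sym mulrC.
by rewrite mnm1E mxvec_index_eq [u == v]eq_sym (negPf vu) andbF mul0r.
Qed.

Hypothesis alphaP : w.-primitive_root alpha.

Lemma alpha_neq0 : alpha != 0.
Proof.
apply/eqP=> al0; have := prim_expr_order alphaP.
rewrite al0 expr0n gtn_eqF ?(prim_order_gt0 alphaP) // => /eqP.
by rewrite eq_sym oner_eq0.
Qed.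

Lemma alpha_exp_inj (u v : 'I_w) : alpha ^+ u.+1 = alpha ^+ v.+1 -> u = v.
Proof.
move/eqP; rewrite (eq_prim_root_expr alphaP) -addn1 -[v.+1]addn1 eqn_modDr.
by rewrite !modn_small ?ltn_ord // => /eqP/val_inj.
Qed.

Lemma alpha_log (b : F) : b != 0 -> exists u : 'I_w, b = alpha ^+ u.+1.
Proof.
move=> b0; have bw : b ^+ w = 1.
  by apply: (mulIf b0); rewrite mul1r -exprSr prednK ?expf_card // (cardD1 0).
have [[[|j] ltj] -> /=] := prim_rootP alphaP bw.
  have w0 := prim_order_gt0 alphaP.
  have lt : (w.-1 < w)%N by rewrite prednK.
  by exists (Ordinal lt); rewrite /= prednK // (prim_expr_order alphaP).
by exists (Ordinal (ltnW ltj)).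
Qed.

Lemma coords_cross a : coords (mnmx (cross alpha a)) = a.
Proof.
apply/rowP=> i; rewrite mxE.
under eq_bigr do rewrite mnmxE mxE.
have [a0|/alpha_log[u au]] := eqVneq (a 0 i) 0.
  rewrite a0 big1 // => u _.
  by rewrite eq_sym (negPf (expf_neq0 _ alpha_neq0)) mul0r.
rewrite (bigD1 u) //= au eqxx mul1r big1 ?addr0 // => v vu.
case: eqP => [/alpha_exp_inj e|_]; last by rewrite mul0r.
by rewrite e eqxx in vu.
Qed.

End Coords.

(** * Reduction modulo the code ideal *)

Section CodeIdeal.
Variables (K : fieldType) (F : finFieldType) (alpha : F) (n : nat).
Variable C : {vspace 'rV[F]_n}.
Notation w := #|F|.-1.
Hypothesis alphaP : w.-primitive_root alpha.
Let I := gen_code_ideal K alpha C.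

Lemma code_ideal_cross a b : a - b \in C ->
  I ('X_[mnmx (cross alpha a)] - 'X_[mnmx (cross alpha b)]).
Proof.
move=> ab; exists ('X_[mnmx (cross alpha a)] - 'X_[mnmx (cross alpha b)]), 0; split.
- by apply: ideal_gen_mem; exists a, b; rewrite !xpow_id.
- exact: ideal_gen0.
by rewrite addr0.
Qed.

Lemma Iq_code_ideal f : Iq K alpha n f -> I f.
Proof. by move=> If; exists 0, f; split; rewrite ?add0r //; apply: ideal_gen0. Qed.

Lemma code_ideal0 : I 0.
Proof. by apply: Iq_code_ideal; apply: ideal_gen0. Qed.

Lemma code_idealD f g : I f -> I g -> I (f + g).
Proof.
case=> a [b [Ia Ib ->]] [a' [b' [Ia' Ib' ->]]]; exists (a + a'), (b + b').
by split; [apply: ideal_genD|apply: ideal_genD|rewrite addrACA].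
Qed.

Lemma code_idealM f g : I g -> I (f * g).
Proof.
case=> a [b [Ia Ib ->]]; exists (f * a), (f * b).
by split; [apply: ideal_genM|apply: ideal_genM|rewrite mulrDr].
Qed.

Definition congI (f g : {mpoly K[n * w]}) := I (f - g).

Lemma congI_refl f : congI f f.
Proof. by rewrite /congI subrr; apply: code_ideal0. Qed.

Lemma congI_sym f g : congI f g -> congI g f.
Proof. by move=> /(code_idealM (-1)); rewrite mulN1r opprB. Qed.

Lemma congI_trans g f h : congI f g -> congI g h -> congI f h.
Proof. by move=> fg /(code_idealD fg); rewrite addrA subrK. Qed.

Lemma congIM f g f' g' : congI f g -> congI f' g' -> congI (f * f') (g * g').
Proof.
move=> /(code_idealM f') fg /(code_idealM g) fg'.
have := code_idealD fg fg'; congr I; rewrite !mulrBr addrA.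
by rewrite [f' * g]mulrC subrK mulrC.
Qed.

(** The contribution of an entry [b] in position [i] to a crossing monomial:
    the variable x_{iu} if [b = alpha ^+ u.+1], and 1 if [b = 0]. *)
Definition cblock (i : 'I_n) (b : F) : {mpoly K[n * w]} :=
  \prod_(u < w) xvar K i u ^+ (b == alpha ^+ u.+1).

Lemma cross_cblock a : 'X_[mnmx (cross alpha a)] = \prod_(i < n) cblock i (a 0 i).
Proof.
rewrite -xpow_id; apply: eq_bigr => i _; apply: eq_bigr => u _.
by rewrite mxE.
Qed.

Lemma cblock0 i : cblock i 0 = 1.
Proof.
by apply: big1 => u _; rewrite eq_sym (negPf (expf_neq0 _ (alpha_neq0 alphaP))).
Qed.

Lemma cblock_alpha i (u : 'I_w) : cblock i (alpha ^+ u.+1) = xvar K i u.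
Proof.
rewrite /cblock (bigD1 u) //= eqxx big1 ?mulr1 // => v vu.
case: eqP => [/(alpha_exp_inj alphaP) uv|_ //].
by rewrite uv eqxx in vu.
Qed.

(** The generators of the ideal [Iq] are the cases where [b] and [c] are
    nonzero. *)
Lemma cblockM i b c : congI (cblock i b * cblock i c) (cblock i (b + c)).
Proof.
have [->|/(alpha_log alphaP)[u ->]] := eqVneq b 0.
  by rewrite cblock0 mul1r add0r; apply: congI_refl.
have [->|/(alpha_log alphaP)[v ->]] := eqVneq c 0.
  by rewrite cblock0 mulr1 addr0; apply: congI_refl.
apply: Iq_code_ideal; apply: ideal_gen_mem; rewrite !cblock_alpha.
have [uv0|/(alpha_log alphaP)[t uvt]] := eqVneq (alpha ^+ u.+1 + alpha ^+ v.+1) 0.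
  by right; exists i, u, v; rewrite uv0 cblock0.
by left; exists i, u, v, t; rewrite uvt cblock_alpha.
Qed.

Lemma crossM a b : congI
  ('X_[mnmx (cross alpha a)] * 'X_[mnmx (cross alpha b)])
  'X_[mnmx (cross alpha (a + b))].
Proof.
rewrite !cross_cblock -big_split.
elim/big_ind2: _ => [|f g f' g'|i _]; first exact: congI_refl.
  exact: congIM.
by rewrite mxE; apply: cblockM.
Qed.

(** A single variable is already the crossing monomial of its vector, and
    [crossM] handles products. *)
Lemma congI_cross m : congI 'X_[m] 'X_[mnmx (cross alpha (coords alpha m))].
Proof.
have P0 : congI 'X_[0%MM] 'X_[mnmx (cross alpha (coords alpha 0%MM))].
  rewrite coords0 mpolyX0 cross_cblock big1 => [|i _]; first exact: congI_refl.
  by rewrite mxE cblock0.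
have PD m1 m2 : congI 'X_[m1] 'X_[mnmx (cross alpha (coords alpha m1))] ->
    congI 'X_[m2] 'X_[mnmx (cross alpha (coords alpha m2))] ->
  congI 'X_[m1 + m2] 'X_[mnmx (cross alpha (coords alpha (m1 + m2)%MM))].
  move=> h1 h2; rewrite coordsD mpolyXD.
  exact: congI_trans (congIM h1 h2) (crossM _ _).
rewrite [m]multinomUE_id; elim/big_ind: _ => // v _.
elim: (m v) => [|e IHe]; first by rewrite mulm0n.
rewrite mulmS; apply: PD => //.
case/mxvec_indexP: v {IHe} => i u; rewrite coordsU cross_cblock.
rewrite (bigD1 i) //= big1 => [|j /negPf ji]; rewrite !mxE ?eqxx /= ?ji /=.
  by rewrite !mulr1 cblock_alpha; apply: congI_refl.
by rewrite mulr0 cblock0.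
Qed.

(** Pass through the crossing monomials of the two vectors, whose difference is
    one of the generators. *)
Lemma code_ideal_binomial m1 m2 :
  coords alpha m1 - coords alpha m2 \in C -> I ('X_[m1] - 'X_[m2]).
Proof.
move=> m12; apply: congI_trans (congI_cross m1) _.
apply: congI_trans (congI_sym (congI_cross m2)).
exact: code_ideal_cross.
Qed.

(** All generators, of both kinds, are differences of two monomials whose
    vectors agree modulo the code. *)
Lemma code_ideal_balanced (V : zmodType) (cls : 'X_{1..n * w} -> V) f :
  {morph cls : m1 m2 / (m1 + m2)%MM >-> m1 + m2} ->
  (forall m1 m2, coords alpha m1 - coords alpha m2 \in C -> cls m1 = cls m2) ->
  I f -> class_balanced cls f.
Proof.
move=> clsD clsC [a [b [Ia Ib ->]]].
apply: class_balancedD.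
  refine (class_balanced_ideal clsD _ Ia) => g.
  case=> c [c' [cc' ->]]; exists (mnmx (cross alpha c)), (mnmx (cross alpha c')).
  by rewrite !xpow_id; split=> //; apply: clsC; rewrite !coords_cross.
refine (class_balanced_ideal clsD _ Ib) => g.
case=> [[j [u [v [t [e ->]]]]]|[j [u [v [e ->]]]]].
  exists (U_(mxvec_index j u) + U_(mxvec_index j v))%MM, U_(mxvec_index j t)%MM.
  split; last by rewrite mpolyXD.
  by apply: clsC; rewrite coordsD !coordsU -scalerDl e subrr mem0v.
exists (U_(mxvec_index j u) + U_(mxvec_index j v))%MM, 0%MM.
split; last by rewrite mpolyXD mpolyX0.
by apply: clsC; rewrite coordsD !coordsU -scalerDl e scale0r coords0 subrr mem0v.
Qed.

End CodeIdeal.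

(** * Syndromes for a standard generator matrix *)

Section Syndrome.
Variables (F : finFieldType) (alpha : F) (k l : nat).
Variables (C : {vspace 'rV[F]_(k + l)}) (G : 'M[F]_(k, k + l)).
Notation w := #|F|.-1.

(** The product of the vector of [m] with the transposed parity check matrix
    of the code, when [G] is standard. *)
Definition synd (m : 'X_{1..(k + l) * w}) : 'rV[F]_l :=
  rsubmx (coords alpha m) - lsubmx (coords alpha m) *m rsubmx G.

Lemma syndD : {morph synd : m1 m2 / (m1 + m2)%MM >-> m1 + m2}.
Proof.
move=> m1 m2; rewrite /synd coordsD !linearD /= mulmxDl.
by rewrite opprD addrACA.
Qed.

Hypothesis genG : is_generator_matrix C G.
Hypothesis stdG : is_standard G.

(** The codeword with information part [u] is [u *m (I | M) = (u | u *m M)]. *)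
Lemma code_memE a : (a \in C) = (rsubmx a == lsubmx a *m rsubmx G).
Proof.
have [M GM] := stdG; have /eqP CG := span_basis genG.
have aG : a = lsubmx a *m G -> a \in C.
  move=> ->; rewrite -(eqP CG) mulmx_sum_row; apply: memv_suml => i _.
  by apply/memvZ/memv_span/tnthP; exists i; rewrite tnth_mktuple.
apply/idP/eqP => [|ra]; last first.
  apply: aG; rewrite -{1}[a]hsubmxK ra GM row_mxKr.
  by rewrite mul_mx_row mulmx1.
rewrite -(eqP CG) => /coord_span aE.
have {aE} -> : a = (\row_i coord [tuple row i G | i < k] i a) *m G.
  rewrite {1}aE mulmx_sum_row; apply: eq_bigr => i _.
  by rewrite mxE -tnth_nth tnth_mktuple.
by rewrite GM row_mxKr mul_mx_row mulmx1 row_mxKl row_mxKr.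
Qed.

Lemma synd_eq m1 m2 :
  synd m1 = synd m2 <-> coords alpha m1 - coords alpha m2 \in C.
Proof.
have synd_sub : synd m1 - synd m2 =
    rsubmx (coords alpha m1 - coords alpha m2) -
    lsubmx (coords alpha m1 - coords alpha m2) *m rsubmx G.
  rewrite /synd !linearB /= mulmxBl.
  by rewrite addrACA opprD.
by rewrite code_memE -subr_eq0 -synd_sub subr_eq0; split=> [->|/eqP].
Qed.

End Syndrome.

(** * Normal forms *)

Section NormalForm.
Variables (F : finFieldType) (p r k l : nat) (alpha : F).
Variable G : 'M[F]_(k, k + l).
Notation w := #|F|.-1.
Hypothesis p_pr : prime p.
Hypothesis cardF : #|F| = (p ^ r)%N.
Hypothesis alphaP : w.-primitive_root alpha.

Definition nf (c : 'rV[F]_l) : 'X_{1..(k + l) * w} :=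
  mnmx (col_mx 0 (rep (phis p r alpha c))).

(** A monomial is standard if all its exponents are less than these bounds. *)
Definition bounds : 'M[nat]_(k + l, w) :=
  col_mx (const_mx 1%N) (\matrix_(i, u) if (#|F| - r <= u.+1)%N then p else 1%N).

Definition bound v := mxvec bounds 0 v.

Lemma boundEl i u : bound (mxvec_index (lshift l i) u) = 1%N.
Proof. by rewrite /bound mxvecE col_mxEu mxE. Qed.

Lemma boundEr i u : bound (mxvec_index (rshift k i) u) =
  if (#|F| - r <= u.+1)%N then p else 1%N.
Proof. by rewrite /bound mxvecE col_mxEd mxE. Qed.

Lemma nf_bound c v : (nf c v < bound v)%N.
Proof.
case/mxvec_indexP: v => i u; rewrite mnmxE.
have [j|j] := split_ordP i => ->; first by rewrite boundEl col_mxEu mxE.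
rewrite boundEr col_mxEd !mxE; case: (leqP (#|F| - r) u.+1) => [_|lt_u].
  by rewrite -[X in (_ < X)%N](Fp_cast p_pr) ltn_ord.
have /andP[/forallP/(_ u)/implyP/(_ lt_u)/eqP-> _] := phiP (c 0 j) p_pr cardF alphaP.
by [].
Qed.

Lemma coords_nf c : coords alpha (nf c) = row_mx 0 c.
Proof.
apply/rowP=> i; rewrite mxE; under eq_bigr do rewrite mnmxE.
have [j|j] := split_ordP i => ->.
  by rewrite row_mxEl mxE big1 // => u _; rewrite col_mxEu mxE mul0r.
rewrite row_mxEr; have /andP[_ /eqP ->] := phiP (c 0 j) p_pr cardF alphaP.
by apply: eq_bigr => u _; rewrite col_mxEd !mxE.
Qed.

Lemma nfK : cancel nf (synd alpha G).
Proof. by move=> c; rewrite /synd coords_nf row_mxKl row_mxKr mul0mx subr0. Qed.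

(** Over F, exponents matter only modulo p; reduced modulo p they are the
    coordinates of the entry in the basis of the last r powers of alpha. *)
Lemma block_phi n (m : 'X_{1..n * w}) i :
    (forall u : 'I_w, (u.+1 < #|F| - r)%N -> m (mxvec_index i u) = 0%N) ->
  \row_u (m (mxvec_index i u))%:R = phi p r alpha (coords alpha m 0 i).
Proof.
move=> m0; apply: phi_uniq => //; apply/andP; split.
  by apply/forallP=> u; apply/implyP=> /m0 mu; rewrite mxE mu.
have pcharF := card_finPcharP cardF p_pr.
rewrite mxE; apply/eqP/eq_bigr => u _.
by rewrite mxE val_Fp_nat // (GRing.natr_mod_pchar pcharF).
Qed.

(** At the first difference the exponent of [m'] could only be the smaller one
    if that of [m] were positive, so at a variable [x] occurring in standard
    monomials.  Then both monomials vanish on the first k blocks and on the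
    early positions of the block of [x], and [block_phi] identifies their
    exponents of [x] modulo p. *)
Lemma nf_min (m m' : 'X_{1..(k + l) * w}) : (forall v, m v < bound v)%N ->
  synd alpha G m = synd alpha G m' -> mlex m m'.
Proof.
move=> std eq_synd; have [->|] := eqVneq m m'; first exact: mlexxx.
case/mnm_first_diff=> v neq_v eq_lt; have [lt_v|lt_v|eq_v] := ltngtP (m v) (m' v).
- apply/orP; right; apply/existsP; exists v; rewrite lt_v.
  by apply/forallP=> j; apply/implyP=> /eq_lt->.
- have := std v; case/mxvec_indexP: v neq_v eq_lt lt_v => i u neq_v eq_lt lt_v.
  have [j ij|j ij] := split_ordP i; rewrite ij in neq_v eq_lt lt_v *.
    by rewrite boundEl; case: (m _) lt_v.
  rewrite boundEr; case: (leqP (#|F| - r) u.+1) => [free_u lt_p|_]; last first.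
    by case: (m _) lt_v.
  have m0 t s : m (mxvec_index (lshift l t) s) = 0%N.
    by have := std (mxvec_index (lshift l t) s); rewrite boundEl; case: (m _).
  (* The first k blocks precede the variable at which m and m' differ. *)
  have m'0 t s : m' (mxvec_index (lshift l t) s) = 0%N.
    rewrite -eq_lt ?m0 // !mxvec_indexE /=.
    rewrite (leq_trans (n := (t.+1 * w)%N)) ?mulSnr ?ltn_add2l //.
    rewrite -mulSnr; apply: leq_trans (leq_addr _ _).
    by rewrite leq_mul2r ltn_addr ?orbT.
  have l0 (q : 'X_{1..(k + l) * w}) :
      (forall t s, q (mxvec_index (lshift l t) s) = 0%N) ->
      lsubmx (coords alpha q) = 0.
    move=> q0; apply/rowP=> t; rewrite !mxE big1 // => s _.
    by rewrite q0 mul0r.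
  move: eq_synd; rewrite /synd !l0 // mul0mx !subr0 => /rowP/(_ j).
  rewrite !(mxE rsubmx_key) => eq_j.
  have mz (s : 'I_w) : (s.+1 < #|F| - r)%N -> m (mxvec_index (rshift k j) s) = 0%N.
    move=> lt_s; have := std (mxvec_index (rshift k j) s).
    by rewrite boundEr (leqNgt (#|F| - r)) lt_s; case: (m _).
  have m'z (s : 'I_w) : (s.+1 < #|F| - r)%N -> m' (mxvec_index (rshift k j) s) = 0%N.
    move=> lt_s; rewrite -eq_lt ?mz // !mxvec_indexE ltn_add2l.
    by rewrite -ltnS (leq_trans lt_s).
  have := block_phi mz; rewrite eq_j -(block_phi m'z) => /rowP/(_ u).
  rewrite !mxE => /(congr1 (@nat_of_ord _)).
  rewrite !val_Fp_nat // !modn_small // ?(ltn_trans lt_v) // => e.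
  by rewrite e ltnn in lt_v.
by rewrite eq_v eqxx in neq_v.
Qed.

(** * The basis polynomials *)

Variable K : fieldType.
Notation corner_poly v :=
  ('X_[corner bound v] - 'X_[corner_tail (synd alpha G) bound nf v]
     : {mpoly K[(k + l) * w]}).

Lemma phi0 : phi p r alpha 0 = 0.
Proof.
symmetry; apply: phi_uniq => //; apply/andP; split.
  by apply/forallP=> u; rewrite mxE eqxx implybT.
by rewrite big1 // => u _; rewrite mxE mul0r.
Qed.

Lemma nf0 : nf 0 = 0%MM.
Proof.
apply/mnmP=> v; case/mxvec_indexP: v => i u; rewrite mnmxE mnm0E.
have [j|j] := split_ordP i => ->; first by rewrite col_mxEu mxE.
by rewrite col_mxEd !mxE phi0 mxE.
Qed.

Lemma synd_lshift i j : synd alpha G U_(mxvec_index (lshift l i) j)%MM = mvec alpha G i j.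
Proof.
rewrite /synd /mvec coordsU !linearZ /= -scalemxAl linearB -scalerBr /=.
congr (_ *: (_ - _)).
have -> : lsubmx (delta_mx 0 (lshift l i)) = delta_mx 0 i :> 'rV[F]_k.
  by apply/rowP=> t; rewrite !mxE.
by rewrite -rowE; apply/rowP=> t; rewrite !mxE.
Qed.

Lemma synd_rshift i j :
  synd alpha G U_(mxvec_index (rshift k i) j)%MM = alpha ^+ j.+1 *: delta_mx 0 i.
Proof.
rewrite /synd coordsU !linearZ /=.
have -> : lsubmx (delta_mx 0 (rshift k i)) = 0 :> 'rV[F]_k.
  by apply/rowP=> t; rewrite !mxE eq_lrshift.
rewrite scaler0 mul0mx subr0; congr (_ *: _).
by apply/rowP=> t; rewrite !mxE eq_rshift.
Qed.

Lemma synd_Mn m e : synd alpha G (m *+ e)%MM = e%:R *: synd alpha G m.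
Proof. by rewrite /synd coordsMn !linearZ /= -scalemxAl scalerBr. Qed.

Lemma corner_poly_info i (j : 'I_w) : corner_poly (mxvec_index (lshift l i) j) =
  xvar K (lshift l i) j - xpow K (@rshift k l) (rep (phis p r alpha (mvec alpha G i j))).
Proof.
by rewrite /corner_tail /corner boundEl mulm1n xpow_rshift synd_lshift.
Qed.

Lemma corner_poly_dep i (j : 'I_w) : (j.+1 <= #|F| - r - 1)%N ->
  corner_poly (mxvec_index (rshift k i) j) =
  xvar K (rshift k i) j -
    xpow K (fun _ : 'I_1 => rshift k i) (rep (phi p r alpha (alpha ^+ j.+1))).
Proof.
move=> lt_j; rewrite /corner_tail /corner boundEr (leqNgt (#|F| - r)).
have -> /= : (j.+1 < #|F| - r)%N by case: (#|F| - r)%N lt_j => // a; rewrite subn1.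
rewrite mulm1n synd_rshift xpow_single xpow_id; congr (_ - 'X_[mnmx _]).
apply/matrixP=> t u; rewrite [RHS]mxE.
have [s|s] := split_ordP t => ->; first by rewrite col_mxEu mxE eq_lrshift mxE.
rewrite col_mxEd eq_rshift !mxE eqxx /=.
case: eqVneq => _; first by rewrite mulr1 !mxE.
by rewrite mulr0 phi0 !mxE.
Qed.

(** The vector of x^p is 0 in characteristic p, so the tail is 1. *)
Lemma corner_poly_free i (j : 'I_w) : (#|F| - r <= j.+1)%N ->
  corner_poly (mxvec_index (rshift k i) j) = xvar K (rshift k i) j ^+ p - 1.
Proof.
move=> le_j; rewrite /corner_tail /corner boundEr le_j synd_Mn.
have pcharF := card_finPcharP cardF p_pr.
by rewrite (GRing.pcharf0 pcharF) scale0r nf0 mpolyX0 mpolyXn.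
Qed.

(** The three families are the corners in the first k blocks, at the early
    positions of the last blocks, and at the last r positions of those. *)
Lemma basis_polys_corner f :
  basis_polys K p r alpha G f <-> exists v, f = corner_poly v.
Proof.
split=> [[[i [j ->]]|[i [j [lt_j ->]]]|[i [j [le_j ->]]]]|[v ->]].
- by exists (mxvec_index (lshift l i) j); rewrite corner_poly_info.
- by exists (mxvec_index (rshift k i) j); rewrite corner_poly_dep.
- by exists (mxvec_index (rshift k i) j); rewrite corner_poly_free.
case/mxvec_indexP: v => i j; have [t|t] := split_ordP i => ->.
  by constructor 1; exists t, j; rewrite corner_poly_info.
have [le_j|lt_j] := leqP (#|F| - r) j.+1.
  by constructor 3; exists t, j; rewrite corner_poly_free.
have le_j : (j.+1 <= #|F| - r - 1)%N by case: (#|F| - r)%N lt_j => // a; rewrite subn1.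
by constructor 2; exists t, j; rewrite corner_poly_dep.
Qed.

End NormalForm.

(** * The reduced basis of the code ideal *)

Theorem theorem4p7 (K : fieldType) (F : finFieldType) (p r k l : nat)
    (alpha : F) (C : {vspace 'rV[F]_(k + l)}) (G : 'M[F]_(k, k + l)) :
  prime p -> (0 < r)%N -> #|F| = (p ^ r)%N ->
  (#|F|.-1).-primitive_root alpha ->
  \dim C = k ->
  is_generator_matrix C G -> is_standard G ->
  is_reduced_groebner (@mlex ((k + l) * #|F|.-1))
    (gen_code_ideal K alpha C)
    (basis_polys K p r alpha G).
Proof.
move=> p_pr _ cardF alphaP _ genG stdG.
have synd_code := synd_eq alpha genG stdG.
refine (staircase_reduced_groebner
  (nf_bound p_pr cardF alphaP) (nfK G p_pr cardF alphaP)
  (nf_min p_pr cardF alphaP) _ _ _).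
- by move=> m m' /synd_code; apply: code_ideal_binomial.
- move=> f; apply: code_ideal_balanced => //; first exact: syndD.
  by move=> m m' /synd_code.
exact: basis_polys_corner.
Qed.
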